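(* Let $q\in(0,1)$ and $r=1-q$, and consider the random graph process $\mathcal{I}_C$ with parameters $q,r$. For all integers $t\ge 1$ and $n\ge 0$, the probability $p_t(n)$ that the graph has exactly $n$ vertices at step $t$ is $$p_t(n)=\begin{cases}\displaystyle\binom{t-1}{t-n+1}q^{n-2}r^{t-n+1} & n>1,\\ 0 & n=0\text{ or }1.\end{cases}$$
   Context: The probabilistic inductive class $\mathcal{I}_C$ (connected undirected graphs, multiple edges allowed, no loops) is the following random graph process. At step $0$ the graph is a single vertex with no edges. At each step one rule is chosen and applied: rule R1 with probability $q$, rule R2 with probability $r=1-q$, independently of the past; except that at the first step only R1 can be applied, so R1 is applied at step $1$ with certainty. R1: choose a vertex uniformly at random, and add one new vertex and one edge joining it to the chosen vertex. R2: choose two different vertices uniformly at random (possibly already adjacent) and add one edge joining them. Convention: $\binom{a}{b}=0$ if $b<0$ or $b>a$. *)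

(* Defs.v *)
From HB Require Import structures.
From mathcomp Require Import all_boot all_order all_algebra.
From mathcomp Require Import all_classical all_reals all_analysis.
Set Implicit Arguments.
Unset Strict Implicit.
Unset Printing Implicit Defensive.
Import Order.TTheory GRing.Theory Num.Theory.
Local Open Scope ring_scope.

Definition vpair (n : nat) := {e : {set 'I_n} | #|e| == 2}.

(* A finite undirected loopless multigraph: the number n of vertices, and the
   multiplicity of each two-element subset of 'I_n as an edge. Connectedness is
   not recorded: it holds for [single_vertex] and is preserved by both rules. *)
Definition mgraph := {n : nat & {ffun vpair n -> nat}}.

Definition nb_vertices (g : mgraph) : nat := tag g.

Definition edge_mult (g : mgraph) : {ffun vpair (nb_vertices g) -> nat} :=
  tagged g.

Definition MGraph (n : nat) (m : {ffun vpair n -> nat}) : mgraph :=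
  Tagged (fun k => {ffun vpair k -> nat}) m.

Definition single_vertex : mgraph := @MGraph 1 [ffun=> 0%N].

(* The new vertex is [ord_max] and the old ones are embedded by
   [lift ord_max]. The preimage under that embedding of a pair containing the
   new vertex has only one element, so that [insub] gives [None] on it. *)
Definition attach_vertex (g : mgraph) (v : 'I_(nb_vertices g)) : mgraph :=
  MGraph [ffun e : vpair (nb_vertices g).+1 =>
    ((val e == [set ord_max; lift ord_max v]%SET)
     + oapp (edge_mult g) 0 (insub (lift ord_max @^-1: val e)%SET))%N].

Definition add_edge (g : mgraph) (p : vpair (nb_vertices g)) : mgraph :=
  MGraph [ffun e : vpair (nb_vertices g) => (edge_mult g e + (e == p))%N].

Inductive rule := R1 | R2.

Section Process.
Context {R : realType}.
Implicit Types (q r : R) (c : rule) (g : mgraph).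

(* Probability that rule [c] is the one applied in passing from step t to
   step t + 1. *)
Definition rule_prob q r (t : nat) c : R :=
  match c with
  | R1 => if t == 0%N then 1 else q
  | R2 => if t == 0%N then 0 else r
  end.

(* Probability that rule [c], applied to [g] with a uniformly random vertex,
   respectively unordered pair of different vertices, produces [g']. *)
Definition outcome_prob g c g' : R :=
  match c with
  | R1 => #|[set v : 'I_(nb_vertices g) | attach_vertex v == g']%SET|%:R
          / (nb_vertices g)%:R
  | R2 => #|[set p : vpair (nb_vertices g) | add_edge p == g']%SET|%:R
          / #|{: vpair (nb_vertices g)}|%:R
  end.

Context {d : measure_display} {T : measurableType d}.

(* [G t] is the graph at step t, and [B t] is the rule applied in passing from
   step t to step t + 1. The past at step t is G 0, ..., G t, B 0, ..., B (t-1). *)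
Definition past (G : nat -> T -> mgraph) (B : nat -> T -> rule) (t : nat)
    (g : nat -> mgraph) (b : nat -> rule) : set T :=
  [set w | (forall s, (s <= t)%N -> G s w = g s) /\
           (forall s, (s < t)%N -> B s w = b s)]%classic.

(* The transition condition is the law of (B t, G (t+1)) conditional on the
   past, multiplied out so that pasts of probability zero need no exception. *)
Record is_IC_process (P : probability T R) (q r : R)
    (G : nat -> T -> mgraph) (B : nat -> T -> rule) : Prop := {
  IC_measurable_graph : forall t g, measurable [set w | G t w = g]%classic;
  IC_measurable_rule : forall t c, measurable [set w | B t w = c]%classic;
  IC_start : P [set w | G 0%N w = single_vertex]%classic = 1%E;
  IC_step : forall t (g : nat -> mgraph) (b : nat -> rule) c g',
    P (past G B t g b `&` [set w | B t w = c /\ G t.+1 w = g'])%classic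
    = (P (past G B t g b)
       * (rule_prob q r t c * outcome_prob (g t) c g')%:E)%E
}.

End Process.

(* Binomial coefficient on integers: zero when b < 0 or b > a. *)
Definition binz (a b : int) : nat :=
  match a, b with
  | Posz m, Posz k => 'C(m, k)
  | _, _ => 0%N
  end.

(* Main.v *)
Require Import Defs.
From HB Require Import structures.
From mathcomp Require Import all_boot all_order all_algebra.
From mathcomp Require Import all_classical all_reals all_analysis.
From mathcomp Require Import ring zify.

(* R1 adds one vertex and R2 none, whatever vertex or pair is drawn, so that
   p_(t+1)(n) = q p_t(n-1) + r p_t(n) for n > 1 and t >= 1, which is Pascal's
   rule for the closed form. The recursion follows by summing the transition
   law over the countably many pasts and graphs. *)

Import Order.TTheory GRing.Theory Num.Theory.
Local Open Scope ring_scope.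

(** * Conditioning on a random variable with countably many values *)

Section CountableConditioning.
Set Implicit Arguments.
Unset Strict Implicit.
Local Open Scope classical_set_scope.
Local Open Scope ereal_scope.
Context {R : realType} {d : measure_display} {T : measurableType d}.
Context (P : probability T R).
Context {K : countType}.
Context (X : T -> K).
Context (mX : forall k, measurable [set w | X w = k]).

(** Events are indexed by codes so that sums over [K] become series over the naturals; an integer
    that codes nothing contributes the empty event. *)
Lemma preimage_pickle i : (exists2 k : K, pickle k = i &
    [set w | pickle (X w) = i] = [set w | X w = k]) \/
  ((forall k : K, pickle k <> i) /\ [set w | pickle (X w) = i] = set0).
Proof.
have [[k <-]|nk] := pselect (exists k : K, pickle k = i); [left|right].
  exists k => //; apply/seteqP; split => w /= => [/(pcan_inj pickleK)//|->//].
split; first by move=> k ki; apply: nk; exists k.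
by apply/seteqP; split => w //= wi; apply: nk; exists (X w).
Qed.

Lemma measurable_pickle i : measurable [set w | pickle (X w) = i].
Proof. by have [[k _ ->]|[_ ->]] := preimage_pickle i. Qed.

Lemma measurable_discrete (S : set K) : measurable [set w | S (X w)].
Proof.
rewrite (_ : mkset _ = \bigcup_(i in [set i | exists2 k, S k & pickle k = i])
    [set w | pickle (X w) = i]).
  by apply: bigcup_measurable => i _; exact: measurable_pickle.
apply/seteqP; split => w /= => [Sw|[i [k Sk <-] /(pcan_inj pickleK) ->//]].
by exists (pickle (X w)) => //; exists (X w).
Qed.

Lemma total_probability (A : set T) : measurable A ->
  P A = \sum_(0 <= i <oo) P (A `&` [set w | pickle (X w) = i]).
Proof.
move=> mA; have AE : A = \bigcup_i (A `&` [set w | pickle (X w) = i]).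
  apply/seteqP; split => w => [Aw|[i _ []//]].
  by exists (pickle (X w)).
rewrite {1}AE measure_bigcup//.
- by apply: eq_eseriesl => i; rewrite in_setT.
- by move=> i _; apply: measurableI => //; exact: measurable_pickle.
- by apply/trivIsetP => i j _ _; apply: contraNeq => /set0P[w [[_ /= <-] [_ <-]]].
Qed.

(** A ratio that is the same on every fibre of [X] holds globally, by total probability. Only
    attained values [X v] need checking, since other fibres are empty. *)
Lemma conditional_const (A B : set T) (c : R) : measurable A -> measurable B ->
  (forall v, P (A `&` [set w | X w = X v])
             = P (B `&` [set w | X w = X v]) * c%:E) ->
  P A = P B * c%:E.
Proof.
move=> mA mB AB; rewrite muleC (total_probability mA) (total_probability mB).
rewrite -nneseriesZl//; apply: eq_eseriesr => i _; rewrite muleC.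
have [[v <-]|nv] := pselect (exists v, pickle (X v) = i).
  have -> : [set w | pickle (X w) = pickle (X v)] = [set w | X w = X v].
    by apply/seteqP; split => w /= => [/(pcan_inj pickleK)|->].
  exact: AB.
have -> : [set w | pickle (X w) = i] = set0.
  by apply/seteqP; split => w //= wi; apply: nv; exists w.
by rewrite !setI0 measure0 mul0e.
Qed.

(** Passes from the probability of each single outcome to that of a property of the outcome: both
    counts become sums over draws [v], and the sums over codes and draws are exchanged. *)
Lemma uniform_image (V : finType) (f : V -> K) (E : set T) (a : \bar R)
    (S : pred K) : measurable E -> 0 <= a ->
  (forall k, P (E `&` [set w | X w = k])
             = a * (#|[set v | f v == k]%SET|%:R / #|V|%:R)%:E) ->
  P (E `&` [set w | S (X w)])
  = a * (#|[set v | S (f v)]%SET|%:R / #|V|%:R)%:E.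
Proof.
move=> mE a0 EX.
have c0 (m : nat) : 0 <= (m%:R / #|V|%:R)%:E :> \bar R.
  by rewrite lee_fin divr_ge0.
have cardE (Q : pred V) : a * (#|[set v | Q v]%SET|%:R / #|V|%:R)%:E
    = \sum_v if Q v then a * (1 / #|V|%:R)%:E else 0.
  rewrite cardsE -sum1_card natr_sum mulr_suml -sumEFin.
  by rewrite ge0_sume_distrr ?big_mkcond// => v _; exact: (c0 1%N).
rewrite total_probability; last first.
  by apply: measurableI => //; exact: (measurable_discrete [set k | S k]).
transitivity (\sum_(0 <= i <oo) \sum_v
    if (pickle (f v) == i) && S (f v) then a * (1 / #|V|%:R)%:E else 0).
  apply: eq_eseriesr => i _.
  have [[k <- ->]|[nk ->]] := preimage_pickle i; last first.
    rewrite setI0 measure0 big1// => v _.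
    by case: eqP => // /nk.
  rewrite (eq_bigr (fun v => if (f v == k) && S k
      then a * (1 / #|V|%:R)%:E else 0)); last first.
    move=> v _; rewrite (inj_eq (pcan_inj pickleK)).
    by case: eqP => // ->.
  case Sk: (S k); last first.
    rewrite big1 => [|v _]; last by rewrite andbF.
    suff -> : E `&` [set w | S (X w)] `&` [set w | X w = k] = set0.
      by rewrite measure0.
    by apply/seteqP; split => w //= [[_ Sw] Xw]; rewrite Xw Sk in Sw.
  have -> : E `&` [set w | S (X w)] `&` [set w | X w = k]
            = E `&` [set w | X w = k].
    apply/seteqP; split => w /= => [[[Ew _] Xw]//|[Ew Xw]].
    by split=> //; split=> //; rewrite Xw.
  by rewrite EX cardE; apply: eq_bigr => v _; rewrite andbT.
have t0 v i : 0 <= (if (pickle (f v) == i) && S (f v)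
    then a * (1 / #|V|%:R)%:E else 0).
  by case: ifP => // _; rewrite mule_ge0// (c0 1%N).
rewrite nneseries_sum// cardE; apply: eq_bigr => v _.
(* A fixed draw contributes only at the code of its own outcome. *)
rewrite (nneseriesD1 (n := pickle (f v)))// eqxx/= eseries0 ?adde0// => i _ /=.
by rewrite eq_sym => /negbTE ->.
Qed.

End CountableConditioning.

(** * Rules and the draws available to them *)

Lemma card_vpair_gt0 n : (0 < #|{: vpair n}|)%N = (1 < n)%N.
Proof.
rewrite card_sub.
have -> : #|[pred e : {set 'I_n} | #|e| == 2%N]| = 'C(n, 2).
  by rewrite -[in RHS](card_ord n) -card_draws cardsE.
by rewrite bin_gt0.
Qed.

(** Coerced to [nat], this is also the number of vertices that the rule adds. *)
Definition is_R1 (c : rule) : bool := if c is R1 then true else false.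

Lemma is_R1_inj : injective is_R1.
Proof. by move=> [] []. Qed.

(** The rule has at least one possible draw on [m] vertices. *)
Definition applicable (c : rule) (m : nat) : bool :=
  if c is R1 then (0 < m)%N else (1 < m)%N.

(** * The one-step law of the process *)

Section ICProcess.
Set Implicit Arguments.
Unset Strict Implicit.
Local Open Scope classical_set_scope.
Context {R : realType} {d : measure_display} {T : measurableType d}.
Context (P : probability T R) (q r : R).
Context (G : nat -> T -> mgraph) (B : nat -> T -> rule).
Context (q0 : 0 <= q) (r0 : 0 <= r) (IC : is_IC_process P q r G B).

Let mG t g : measurable [set w | G t w = g].
Proof. exact: IC_measurable_graph IC t g. Qed.

Let mB t c : measurable [set w | B t w = c].
Proof. exact: IC_measurable_rule IC t c. Qed.

Let mnbG t n : measurable [set w | nb_vertices (G t w) = n].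
Proof. exact: (measurable_discrete (mG t) [set g | nb_vertices g = n]). Qed.

Lemma rule_prob_ge0 t c : 0 <= rule_prob q r t c.
Proof. by case: c => /=; case: eqP. Qed.

(* Rules are coded as booleans to make the history take values in a countType. *)
Definition history t w : seq mgraph * seq bool :=
  ([seq G s w | s <- iota 0 t.+1], [seq is_R1 (B s w) | s <- iota 0 t]).

Lemma history_past t v : [set w | history t w = history t v]
  = past G B t (G ^~ v) (B ^~ v).
Proof.
apply/seteqP; split => w /=.
  move=> e; move: (congr1 fst e) (congr1 snd e).
  move=> /eq_in_map hG /eq_in_map hB; split=> s st.
    by apply: hG; rewrite mem_iota add0n ltnS.
  by apply: is_R1_inj; apply: hB; rewrite mem_iota add0n.
case=> hG hB; congr (_, _); apply/eq_in_map => s.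
  by rewrite mem_iota add0n ltnS; exact: hG.
by rewrite mem_iota add0n => /andP[_ /hB ->].
Qed.

Lemma measurable_past t g b : measurable (past G B t g b).
Proof.
rewrite (_ : past _ _ _ _ _ =
    (\bigcap_(s in [set s | (s <= t)%N]) [set w | G s w = g s]) `&`
    (\bigcap_(s in [set s | (s < t)%N]) [set w | B s w = b s])) //.
by apply: measurableI; apply: bigcap_measurableType => s _.
Qed.

Lemma measurable_history t k : measurable [set w | history t w = k].
Proof.
have [[v <-]|nv] := pselect (exists v, history t v = k).
  by rewrite history_past; exact: measurable_past.
rewrite (_ : mkset _ = set0)//; apply/seteqP; split => w //= wk.
by apply: nv; exists w.
Qed.

(** Averages the transition law over histories: its factor depends on the past only through the
    current graph, and pasts ending at a graph other than [g] contribute zero to both sides. *)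
Lemma markov_step t g c g' :
  P ([set w | G t w = g] `&` [set w | B t w = c] `&` [set w | G t.+1 w = g'])
  = (P [set w | G t w = g]
     * (rule_prob q r t c * outcome_prob g c g')%:E)%E.
Proof.
apply: (conditional_const (measurable_history t)) => [||v].
- by apply: measurableI => //; exact: measurableI.
- exact: mG.
rewrite history_past.
have [<-{g}|gv] := eqVneq (G t v) g; last first.
  have e0 A : A `<=` [set w | G t w = g] ->
      P (A `&` past G B t (G ^~ v) (B ^~ v)) = 0%E.
    move=> Ag; rewrite (_ : _ `&` _ = set0) ?measure0//.
    apply/seteqP; split => w //= [/Ag /= wg [/(_ t (leqnn t)) e _]].
    by rewrite -wg e eqxx in gv.
  by rewrite !e0 ?mul0e// => w [[]].
have pG : past G B t (G ^~ v) (B ^~ v) `<=` [set w | G t w = G t v].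
  by move=> w [/(_ t (leqnn t))].
rewrite [X in (_ = P X * _)%E]setIC (setIidl pG).
rewrite -(IC_step IC) setIC; congr (P _).
apply/seteqP; split => w /=.
  by move=> [pw [[_ ?] ?]].
by move=> [pw [? ?]]; split=> //; split => //; split => //; exact: pG.
Qed.

(** All draws of a rule give the same number of vertices, so the favourable fraction is 0 or 1;
    without any draw it is 0/0, which is 0 here. *)
Lemma nb_vertices_step_at t g c n :
  P ([set w | G t w = g] `&` [set w | B t w = c]
     `&` [set w | nb_vertices (G t.+1 w) = n])
  = (P [set w | G t w = g] * (rule_prob q r t c
      * (applicable c (nb_vertices g)
         && (is_R1 c + nb_vertices g == n)%N)%:R)%:E)%E.
Proof.
have card_const (V : finType) (b : bool) :
    #|[set v : V | b]%SET|%:R / #|V|%:R = ((0 < #|V|)%N && b)%:R :> R.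
  have [V0|V0] := posnP #|V|; first by rewrite V0 invr0 mulr0.
  case: b; last by rewrite cardsE card0 mul0r andbF.
  by rewrite cardsE divff// pnatr_eq0 -lt0n.
have mE : measurable ([set w | G t w = g] `&` [set w | B t w = c]).
  exact: measurableI.
have a0 : (0 <= P [set w | G t w = g] * (rule_prob q r t c)%:E)%E.
  by rewrite mule_ge0// lee_fin rule_prob_ge0.
have -> : [set w | nb_vertices (G t.+1 w) = n]
    = [set w | [pred h | nb_vertices h == n] (G t.+1 w)].
  by apply/seteqP; split => w /= /eqP.
case: c mE a0 => mE a0.
- rewrite (uniform_image (mG t.+1) (f := @attach_vertex g)
    [pred h | nb_vertices h == n] mE a0) => [|k].
    by rewrite /= card_const card_ord EFinM muleA.
  by rewrite markov_step EFinM muleA /= card_ord.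
- rewrite (uniform_image (mG t.+1) (f := @add_edge g)
    [pred h | nb_vertices h == n] mE a0) => [|k].
    by rewrite /= card_const card_vpair_gt0 EFinM muleA.
  by rewrite markov_step EFinM muleA.
Qed.

Lemma nb_vertices_step t c n :
  P ([set w | B t w = c] `&` [set w | nb_vertices (G t.+1 w) = n])
  = (P [set w | nb_vertices (G t w) = (n - is_R1 c)%N]
     * (rule_prob q r t c * (1 < n)%N%:R)%:E)%E.
Proof.
apply: (conditional_const (mG t)) => [||v]; [exact: measurableI|exact: mnbG|].
rewrite setIC setIA nb_vertices_step_at.
have [e|ne] := eqVneq (nb_vertices (G t v)) (n - is_R1 c)%N.
  rewrite (_ : [set w | nb_vertices (G t w) = (n - is_R1 c)%N] `&` _
             = [set w | G t w = G t v]); last first.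
    by apply/seteqP; split => w /= => [[]//|Gw]; rewrite Gw.
  (* R1 on [n - 1] vertices and R2 on [n] vertices are both applicable exactly when [1 < n]; this
     also neutralises the truncated [n - 1] at [n = 0]. *)
  congr (_ * (_ * _%:R)%:E)%E; rewrite e.
  by case: c {e} => /=; lia.
rewrite (_ : [set w | nb_vertices (G t w) = (n - is_R1 c)%N] `&` _ = set0);
  last first.
  apply/seteqP; split => w //= [e Gw].
  by rewrite -Gw e eqxx in ne.
rewrite measure0 mul0e (_ : _ && _ = false) ?mulr0 ?mule0//.
by apply/negP => /andP[_ /eqP e]; move: ne; rewrite -e addKn eqxx.
Qed.

(** * Recursion and closed form for the number of vertices *)

Lemma nb_vertices_rec t n : P [set w | nb_vertices (G t.+1 w) = n]
  = (P [set w | nb_vertices (G t w) = n.-1]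
       * (rule_prob q r t R1 * (1 < n)%N%:R)%:E
     + P [set w | nb_vertices (G t w) = n]
       * (rule_prob q r t R2 * (1 < n)%N%:R)%:E)%E.
Proof.
have := nb_vertices_step t R1 n; rewrite subn1 => <-.
have := nb_vertices_step t R2 n; rewrite subn0 => <-.
rewrite -measureU; [|exact: measurableI|exact: measurableI|].
  congr (P _); apply/seteqP; split => w /= => [nw|[[]|[]]//].
  by case: (B t w); [left|right].
by apply/seteqP; split => w //= [[-> _] []].
Qed.

Lemma nb_vertices_start n :
  P [set w | nb_vertices (G 0 w) = n] = (n == 1%N)%:R%:E.
Proof.
have [->|n1] := eqVneq n 1%N.
  apply/eqP; rewrite eq_le probability_le1//= -(IC_start IC).
  by rewrite le_measure ?inE// => w /= ->.
(* The start is prescribed only almost surely, so for [n] other than 1 the event lies in a null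
   set. *)
rewrite (_ : mkset _ = [set w | nb_vertices (G 0 w) = n] `&`
    ~` [set w | G 0 w = single_vertex]); last first.
  apply/seteqP; split => w /= => [e|[]//]; split=> // e1.
  by rewrite -e e1 eqxx in n1.
apply/eqP; rewrite eq_le measure_ge0 andbT.
have P0 : P (~` [set w | G 0%N w = single_vertex]) = 0%E.
  by rewrite probability_setC// (IC_start IC) subee.
rewrite -[leRHS]P0; apply: le_measure; rewrite ?inE//.
  by apply: measurableI => //; exact: measurableC.
exact: measurableC.
Qed.

(** After the forced first step there are two vertices, and [k] counts the uses of R1 among the [s]
    remaining steps. *)
Lemma nb_vertices_law s n : P [set w | nb_vertices (G s.+1 w) = n]
  = (if n is k.+2 then 'C(s, k)%:R * q ^+ k * r ^+ (s - k) else 0)%:E.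
Proof.
elim: s n => [|s IH] n; rewrite nb_vertices_rec.
  rewrite !nb_vertices_start /= mul0r mule0 adde0 -EFinM mul1r.
  case: n => [|[|[|n]]] /=; rewrite ?bin0 ?bin0n ?expr0 ?mulr0 ?mulr1 ?mul0r//.
rewrite !IH /= -!EFinM -EFinD; congr EFin.
case: n => [|[|[|k]]] /=; rewrite ?mulr0 ?mul0r ?add0r ?mulr1//.
  by rewrite !bin0 !subn0 !mul1r exprSr.
rewrite binS natrD subSS exprSr.
(* When [s <= k] the exponent [s - k.+1] is truncated, but its coefficient vanishes. *)
have [sk|sk] := leqP s k.
  rewrite (@bin_small s k.+1)//; ring.
by rewrite -(subnSK sk) exprSr; ring.
Qed.

End ICProcess.

(** Symmetry of binomial coefficients, with [s = t - 1] and [k = n - 2]. For [k > s] both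
    coefficients are zero, which cancels the negative power of [r]. *)
Lemma binomial_weight_binz (F : fieldType) (q r : F) (s k : nat) :
  'C(s, k)%:R * q ^+ k * r ^+ (s - k)
  = (binz (s.+1%:Z - 1) (s.+1%:Z - k.+2%:Z + 1))%:R
    * q ^ (k.+2%:Z - 2) * r ^ (s.+1%:Z - k.+2%:Z + 1).
Proof.
have -> : s.+1%:Z - 1 = s%:Z by lia.
have -> : k.+2%:Z - 2 = k%:Z by lia.
have [ks|sk] := leqP k s.
  have -> : s.+1%:Z - k.+2%:Z + 1 = (s - k)%N%:Z by lia.
  by rewrite /= bin_sub.
have -> : s.+1%:Z - k.+2%:Z + 1 = Negz (k - s).-1 by lia.
by rewrite /= bin_small ?mul0r.
Qed.

Theorem lemma5p2 (R : realType) (d : measure_display) (T : measurableType d)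
    (P : probability T R) (q r : R)
    (G : nat -> T -> mgraph) (B : nat -> T -> rule) :
  0 < q < 1 -> r = 1 - q ->
  is_IC_process P q r G B ->
  forall t n : nat, (1 <= t)%N ->
  P [set w | nb_vertices (G t w) = n]%classic
  = (if (1 < n)%N
     then (binz (t%:Z - 1) (t%:Z - n%:Z + 1))%:R
          * q ^ (n%:Z - 2) * r ^ (t%:Z - n%:Z + 1)
     else 0)%:E.
Proof.
move=> /andP[q0 q1] rE IC [|s]// n _.
have r0 : 0 <= r by rewrite rE subr_ge0 ltW.
rewrite (nb_vertices_law (ltW q0) r0 IC).
by case: n => [|[|k]] //; rewrite binomial_weight_binz.
Qed.
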